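(* Let $q$ and $r$ be semi-definite real quadratic forms on $\mathbb{R}^n$ such that $Z_q \subset Z_r$; that is, for all $\mathbf{x} \in \mathbb{R}^n$, $q(\mathbf{x}) = 0 \implies r(\mathbf{x}) = 0$. Then $r$ and $q$ are simultaneously diagonalizable.
   Context: A function $q : \mathbb{R}^n \to \mathbb{R}$ is a real quadratic form if there is a symmetric bilinear function $\tilde{q} : \mathbb{R}^n \times \mathbb{R}^n \to \mathbb{R}$ such that $q(\mathbf{x}) = \tilde{q}(\mathbf{x}, \mathbf{x})$ for all $\mathbf{x}$. The zero set of $q$ is $Z_q = \{\mathbf{x} \in \mathbb{R}^n : q(\mathbf{x}) = 0\}$. A real quadratic form $q$ is semi-definite if $q(\mathbf{x}) \ge 0$ for all $\mathbf{x}$ or $q(\mathbf{x}) \le 0$ for all $\mathbf{x}$ (the two forms $q$ and $r$ need not have the same sign). Two real quadratic forms $q$ and $r$ on $\mathbb{R}^n$ are simultaneously diagonalizable if there is a basis $\{\mathbf{v}_1, \dots, \mathbf{v}_n\}$ of $\mathbb{R}^n$ in which the matrices $[\tilde{q}(\mathbf{v}_i, \mathbf{v}_j)]$ and $[\tilde{r}(\mathbf{v}_i, \mathbf{v}_j)]$ representing $q$ and $r$ are both diagonal. *)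

(* Defs.v *)
From HB Require Import structures.
From mathcomp Require Import all_boot all_order all_algebra.
From mathcomp Require Import classical_sets reals.

Set Implicit Arguments.
Unset Strict Implicit.
Unset Printing Implicit Defensive.

Import Order.TTheory GRing.Theory Num.Theory.

Local Open Scope classical_set_scope.
Local Open Scope ring_scope.

(* R^n is the space 'rV[R]_n of row vectors over R : realType. *)

Definition is_polar_form (R : realType) (n : nat) (q : 'rV[R]_n -> R)
    (b : {symmetric 'rV[R]_n}) : Prop :=
  forall x, q x = b x x.

Definition is_quadratic_form (R : realType) (n : nat)
    (q : 'rV[R]_n -> R) : Prop :=
  exists b : {symmetric 'rV[R]_n}, is_polar_form q b.

Definition zero_set (R : realType) (n : nat) (q : 'rV[R]_n -> R) :
    set 'rV[R]_n :=
  [set x | q x = 0].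

Definition semi_definite (R : realType) (n : nat) (q : 'rV[R]_n -> R) : Prop :=
  (forall x, 0 <= q x) \/ (forall x, q x <= 0).

Definition gram_matrix (R : realType) (n : nat) (b : {symmetric 'rV[R]_n})
    (v : n.-tuple 'rV[R]_n) : 'M[R]_n :=
  \matrix_(i, j) b (tnth v i) (tnth v j).

(* The polar form of a quadratic form is unique because 2 is invertible in R,
   so quantifying it existentially is the same as fixing it. *)
Definition simultaneously_diagonalizable (R : realType) (n : nat)
    (q r : 'rV[R]_n -> R) : Prop :=
  exists bq br : {symmetric 'rV[R]_n},
    [/\ is_polar_form q bq, is_polar_form r br &
        exists v : n.-tuple 'rV[R]_n,
          [/\ basis_of fullv v, is_diag_mx (gram_matrix bq v) &
              is_diag_mx (gram_matrix br v)]].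

(* Main.v *)
(* After changing signs both forms are nonnegative, and we induct on the
   dimension by splitting off a vector v together with a hyperplane that is
   orthogonal to v for both forms and does not contain v.  If q(v) = 0 for some
   v <> 0, then r(v) = 0, so v is in the radical of both forms and any complement
   of v will do.  Otherwise q is positive definite, r/q attains its maximum a on
   the unit sphere at some v, and a q - r is nonnegative and vanishes at v;
   hence v is in its radical, i.e. r(v, .) = a q(v, .), and the q-orthogonal of v
   is also r-orthogonal to v. *)
Require Import Defs.
From HB Require Import structures.
From mathcomp Require Import all_boot all_order all_algebra.
From mathcomp Require Import classical_sets reals.
From mathcomp Require Import boolp topology normedtype derive.

Import Order.TTheory GRing.Theory Num.Theory.
Import numFieldTopology.Exports numFieldNormedType.Exports.

Local Open Scope classical_set_scope.
Local Open Scope ring_scope.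

(** * Bilinear forms given by matrices acting on row vectors *)

Definition mxform {R : pzRingType} {n : nat} (A : 'M[R]_n) (x y : 'rV[R]_n) : R :=
  (x *m A *m y^T) 0 0.

Section MxformAlgebra.
Context {R : comPzRingType} {n : nat}.
Implicit Types (A : 'M[R]_n) (x y z : 'rV[R]_n) (a : R).

Lemma mxformDl A x y z : mxform A (x + y) z = mxform A x z + mxform A y z.
Proof. by rewrite /mxform !mulmxDl mxE. Qed.

Lemma mxformDr A x y z : mxform A z (x + y) = mxform A z x + mxform A z y.
Proof. by rewrite /mxform linearD mulmxDr mxE. Qed.

Lemma mxformZl A a x y : mxform A (a *: x) y = a * mxform A x y.
Proof. by rewrite /mxform -!scalemxAl mxE. Qed.

Lemma mxformZr A a x y : mxform A x (a *: y) = a * mxform A x y.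
Proof. by rewrite /mxform linearZ -scalemxAr mxE. Qed.

Lemma mxformZZ A a x : mxform A (a *: x) (a *: x) = a ^+ 2 * mxform A x x.
Proof. by rewrite mxformZl mxformZr mulrA. Qed.

Lemma mxform_scale A a x y : mxform (a *: A) x y = a * mxform A x y.
Proof. by rewrite /mxform -scalemxAr -scalemxAl mxE. Qed.

Lemma mxformB A B x y : mxform (A - B) x y = mxform A x y - mxform B x y.
Proof. by rewrite /mxform mulmxBr mulmxBl !mxE. Qed.

Lemma mxformC A x y : A^T = A -> mxform A x y = mxform A y x.
Proof.
move=> sA; rewrite /mxform -[x *m A *m y^T]trmxK mxE.
by rewrite !trmx_mul trmxK sA mulmxA.
Qed.

Lemma mxformE A x y : mxform A x y = \sum_j \sum_i x 0 i * A i j * y 0 j.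
Proof.
rewrite /mxform mxE; apply: eq_bigr => j _.
by rewrite !mxE mulr_suml.
Qed.

(** Congruence by [P] pulls the form back along [x] to [x *m P], so hypotheses on [A] pass to its
    restriction to a hyperplane. *)
Lemma mxform_congr m (P : 'M[R]_(m, n)) A (x y : 'rV[R]_m) :
  mxform (P *m A *m P^T) x y = mxform A (x *m P) (y *m P).
Proof. by rewrite /mxform trmx_mul !mulmxA. Qed.

End MxformAlgebra.

(** * Semidefinite real forms and their joint diagonalization by congruence *)

Section RealForms.
Context {R : realType}.

Definition possemidef {n} (A : 'M[R]_n) := forall x, 0 <= mxform A x x.

Lemma mulmx_tr_eq0 n (u : 'rV[R]_n) : (u *m u^T) 0 0 = 0 -> u = 0.
Proof.
rewrite mxE => /eqP; rewrite psumr_eq0 => [/allP u0|i _]; last first.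
  by rewrite mxE -expr2 sqr_ge0.
apply/rowP => i; have /= := u0 i (mem_index_enum i).
by rewrite !mxE -expr2 sqrf_eq0 => /eqP.
Qed.

(* [mxform A (t v + y) (t v + y)] is affine in [t] when [v] is isotropic, so it
   can only stay nonnegative if its slope vanishes; test with [y = v A]. *)
Lemma possemidef_isotropic n (A : 'M[R]_n) v :
  A^T = A -> possemidef A -> mxform A v v = 0 -> v *m A = 0.
Proof.
move=> sA pA v0; apply: mulmx_tr_eq0.
set y := v *m A; have -> : (y *m y^T) 0 0 = mxform A v y by [].
apply/eqP; apply: contraT => s0.
(* This [t] solves [2 * t * mxform A v y + mxform A y y = -1], so the form would be negative at
   [t *: v + y]. *)
pose t := - (mxform A y y + 1) / (2 * mxform A v y).
have := pA (t *: v + y).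
rewrite mxformDl !mxformDr mxformZZ v0 mulr0 add0r mxformZl mxformZr.
rewrite (mxformC A y v sA) addrA -mulr2n -mulrnAr -mulr_natl /t divfK.
  by rewrite opprD addrAC addNr sub0r oppr_ge0 leNgt ltr01.
by rewrite mulf_neq0 // pnatr_eq0.
Qed.

Lemma mxform_continuous n (A : 'M[R]_n) :
  continuous (fun x : 'rV[R]_n => mxform A x x : R).
Proof.
have cM (f g : 'rV[R]_n -> R) :
    continuous f -> continuous g -> continuous (fun x => f x * g x).
  by move=> cf cg x; exact: cvgM (cf x) (cg x).
under eq_fun do rewrite mxformE.
apply: continuous_big => [|j _]; first exact: add_continuous.
apply: continuous_big => [|i _]; first exact: add_continuous.
apply: (cM (fun x => x 0 i * A i j)); last exact: coord_continuous.
apply: (cM (fun x => x 0 i) (fun=> A i j)); first exact: coord_continuous.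
exact: cst_continuous.
Qed.

(** The quotient of the two forms is continuous on the compact unit sphere, so it has a maximum [a]
    there; being homogeneous of degree 0, it is bounded by [a] at every nonzero vector. *)
Lemma mxform_sphere_max n (A B : 'M[R]_n.+1) :
  (forall x, x != 0 -> 0 < mxform B x x) ->
  exists v a, [/\ v != 0, mxform A v v = a * mxform B v v &
    forall x, mxform A x x <= a * mxform B x x].
Proof.
move=> pB; pose S := [set x : 'rV[R]_n.+1 | `|x| = 1].
have S0 : S !=set0.
  (* The dimension [n.+1] is positive, so the all-ones row is nonzero and can be normalized. *)
  exists (`|const_mx 1 : 'rV[R]_n.+1|^-1 *: const_mx 1).
  rewrite /S /mkset. rewrite normrZ normfV normr_id mulVf // normr_eq0.
  by apply/eqP => /rowP /(_ 0) /eqP; rewrite !mxE oner_eq0.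
have cS : compact S.
  apply: bounded_closed_compact.
    exists 1; split; first exact: num_real.
    by move=> M M1 x /= ->; exact: ltW.
  apply: (@preimage_closed _ _ (fun x : 'rV[R]_n.+1 => `|x|) [set 1]).
    by move=> x _; exact: norm_continuous.
  exact: closed_eq.
have Sn0 x : S x -> x != 0.
  by move=> Sx; rewrite -normr_eq0 Sx oner_eq0.
have cf : {within S, continuous (fun x => mxform A x x / mxform B x x)}.
  apply: continuous_in_subspaceT => x /set_mem Sx.
  have Bx : mxform B x x != 0 by rewrite gt_eqF // pB // Sn0.
  exact: cvgM (mxform_continuous _ A x) (cvgV Bx (mxform_continuous _ B x)).
have [v /set_mem Sv vmax] := compact_EVT_max S0 cS cf.
have Bv := pB _ (Sn0 _ Sv).
exists v, (mxform A v v / mxform B v v); split; first exact: Sn0.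
  by rewrite divfK // gt_eqF.
move=> x; have [->|x0] := eqVneq x 0.
  by rewrite -(scale0r v) !mxformZZ expr0n /= !mul0r mulr0.
have nx : 0 < `|x| by rewrite normr_gt0.
have Sx : S (`|x|^-1 *: x) by rewrite /S /mkset normrZ normfV normr_id mulVf // gt_eqF.
have := vmax _ (mem_set Sx); rewrite !mxformZZ ler_pdivrMr.
  rewrite mulrCA ler_pM2l // exprn_gt0 // invr_gt0 //.
by rewrite mulr_gt0 ?pB // exprn_gt0 // invr_gt0.
Qed.

(* The kernel of [w^T] is the hyperplane orthogonal to [v] for both forms. *)
Lemma common_orthogonal_split n (A B : 'M[R]_n.+1) :
  A^T = A -> B^T = B -> possemidef A -> possemidef B ->
  (forall x, mxform B x x = 0 -> mxform A x x = 0) ->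
  exists (v w : 'rV[R]_n.+1) (a b : R),
    [/\ (v *m w^T) 0 0 != 0, v *m A = a *: w & v *m B = b *: w].
Proof.
move=> sA sB pA pB BA.
have [[v /andP[v0 /eqP Bv]]|noiso] :=
  pselect (exists v : 'rV[R]_n.+1, (v != 0) && (mxform B v v == 0)).
  (* Here [v] lies in both radicals, so both coefficients are 0 and [w] need only satisfy
     [v *m w^T != 0]. *)
  exists v, v, 0, 0; split.
  - by apply: contra v0 => /eqP /mulmx_tr_eq0 ->.
  - by rewrite scale0r possemidef_isotropic // BA.
  - by rewrite scale0r possemidef_isotropic.
have dB x : x != 0 -> 0 < mxform B x x.
  move=> x0; rewrite lt_neqAle pB andbT eq_sym; apply/negP => Bx.
  by apply: noiso; exists x; rewrite x0.
have [v [a [v0 Av amax]]] := mxform_sphere_max n A B dB.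
(* With [w = v *m B], the pairing [v *m w^T] is [mxform B v v > 0]; the relation for [A] says that
   [v] is in the radical of [a *: B - A]. *)
exists v, (v *m B), a, 1; split; last by rewrite scale1r.
- have := dB _ v0; rewrite lt_neqAle eq_sym => /andP[+ _]; apply: contra.
  by rewrite trmx_mul sB mulmxA.
- apply/eqP; rewrite eq_sym -subr_eq0; apply/eqP.
  rewrite scalemxAr -mulmxBr; apply: possemidef_isotropic.
  + by rewrite linearB linearZ /= sA sB.
  + by move=> x; rewrite mxformB mxform_scale subr_ge0.
  + by rewrite mxformB mxform_scale Av subrr.
Qed.

(** The rows of [K] are a basis of the kernel of [w^T], of dimension [n] since [w] is nonzero, and
    [v] lies outside it. *)
Lemma hyperplane_frame n (v w : 'rV[R]_n.+1) : (v *m w^T) 0 0 != 0 ->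
  exists K : 'M[R]_(n, n.+1),
    K *m w^T = 0 /\ (col_mx v K : 'M_(1 + n)) \in unitmx.
Proof.
move=> vw; have rk : \rank (kermx w^T) = n.
  rewrite mxrank_ker mxrank_tr rank_rV.
  suff -> : w != 0 by rewrite subn1.
  by apply: contra vw => /eqP->; rewrite trmx0 mulmx0 mxE.
have [K fK Kw] : exists2 K : 'M[R]_(n, n.+1), row_free K & K *m w^T = 0.
  (* The row base is generalized so that its number of rows, a rank, can be rewritten to [n]. *)
  move: (row_base (kermx w^T)) (row_base_free (kermx w^T))
    (eq_row_base (kermx w^T)).
  rewrite rk => K fK eK; exists K => //.
  by apply/sub_kermxP; rewrite eK.
exists K; split=> //; rewrite -row_free_unit; apply: inj_row_free => u.
rewrite -[u]hsubmxK mul_row_col => uvK.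
have l0 : lsubmx u = 0 :> 'rV[R]_1.
  (* Multiplying by [w^T] kills the rows of [K] and isolates the coefficient of [v]. *)
  have := congr1 (mulmx^~ w^T) uvK; rewrite /= mul0mx mulmxDl -!mulmxA Kw mulmx0 addr0.
  move/rowP/(_ 0); rewrite mxE big_ord1 [RHS]mxE => /eqP.
  rewrite mulf_eq0 (negPf vw) orbF => /eqP l0.
  by apply/rowP => i; rewrite ord1 l0 mxE.
move: uvK; rewrite l0 mul0mx add0r => rK.
have -> : rsubmx u = 0 by apply: (row_free_inj fK); rewrite mul0mx.
exact: row_mx0.
Qed.

(** The mixed block [K *m A *m v^T] is the transpose of [v *m A *m K^T], hence equals
    [a *: (K *m w^T) = 0]. *)
Lemma congr_block_diag n (A : 'M[R]_(1 + n)) (v w : 'rV[R]_(1 + n)) a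
    (K : 'M[R]_(n, 1 + n)) :
  A^T = A -> v *m A = a *: w -> K *m w^T = 0 ->
  col_mx v K *m A *m (col_mx v K)^T =
    block_mx (v *m A *m v^T) 0 0 (K *m A *m K^T).
Proof.
move=> sA vA Kw.
have KA : K *m A *m v^T = 0.
  by rewrite -mulmxA -{1}sA -trmx_mul vA linearZ /= -scalemxAr Kw scaler0.
rewrite tr_col_mx mul_col_mx mul_col_row KA; congr block_mx.
by apply: trmx_inj; rewrite !trmx_mul trmxK sA mulmxA KA trmx0.
Qed.

Lemma psd_pencil_diagonalizable n (A B : 'M[R]_n) :
  A^T = A -> B^T = B -> possemidef A -> possemidef B ->
  (forall x, mxform B x x = 0 -> mxform A x x = 0) ->
  exists P : 'M[R]_n,
    [/\ P \in unitmx, is_diag_mx (P *m A *m P^T) & is_diag_mx (P *m B *m P^T)].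
Proof.
elim: n A B => [|n IHn] A B sA sB pA pB BA.
  exists 1%:M; split; first exact: unitmx1.
  - by apply/is_diag_mxP => -[].
  - by apply/is_diag_mxP => -[].
have [v [w [a [b [vw vA vB]]]]] := common_orthogonal_split n A B sA sB pA pB BA.
have [K [Kw uQ]] := hyperplane_frame n v w vw.
have sym (C : 'M[R]_n.+1) : C^T = C -> (K *m C *m K^T)^T = K *m C *m K^T.
  by move=> sC; rewrite !trmx_mul trmxK sC mulmxA.
have [|||P [uP dA dB]] := IHn (K *m A *m K^T) (K *m B *m K^T) (sym _ sA) (sym _ sB).
- by move=> x; rewrite mxform_congr.
- by move=> x; rewrite mxform_congr.
- by move=> x; rewrite !mxform_congr; exact: BA.
(* [L] keeps [v] and replaces the rows of [K] by those of [P *m K], which diagonalize both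
   restrictions. *)
pose L : 'M[R]_(1 + n) := block_mx 1%:M 0 0 P.
pose Q : 'M[R]_(1 + n) := col_mx v K.
have uL : L \in unitmx by rewrite unitmxE det_lblock det1 mul1r -unitmxE.
have dLQ (C : 'M[R]_(1 + n)) c : C^T = C -> v *m C = c *: w ->
    is_diag_mx (P *m (K *m C *m K^T) *m P^T) ->
    is_diag_mx ((L *m Q) *m C *m (L *m Q)^T).
  move=> sC vC dC; rewrite trmx_mul mulmxA -(mulmxA L Q C) -(mulmxA L).
  rewrite (congr_block_diag n C v w c K sC vC Kw) /L tr_block_mx !mulmx_block.
  rewrite !(mul0mx, mulmx0, trmx0, addr0, add0r, mul1mx).
  rewrite is_diag_block_mx // !eqxx dC andbT /=.
  by apply/is_diag_mxP => i j; rewrite !ord1 eqxx.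
exists (L *m Q); split.
- rewrite unitmx_mul uQ andbT; exact: uL.
- exact: (dLQ A a).
- exact: (dLQ B b).
Qed.

End RealForms.

(** * From quadratic forms and bases back to matrices and congruence *)

Lemma semi_definite_sign {R : realType} {n : nat} {q : 'rV[R]_n -> R} :
  semi_definite q -> exists2 e : R, e != 0 & forall x, 0 <= e * q x.
Proof.
case=> qs; [exists 1 | exists (- 1)]; rewrite ?oppr_eq0 ?oner_eq0 // => x.
  by rewrite mul1r.
by rewrite mulN1r oppr_ge0.
Qed.

Lemma symmetric_formE {R : realType} {n : nat} (b : {symmetric 'rV[R]_n}) x y :
  b x y = mxform (matrix_of_form b) x y.
Proof.
(* [form_of_matrix] is a trace with a twist on one argument; here the matrix is 1 by 1 and the twist
   is the identity. *)
by rewrite -[LHS](matrix_of_formK b) /form_of_matrix trace_mx11 map_mx_id.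
Qed.

Lemma matrix_of_symmetric_form {R : realType} {n : nat} (b : {symmetric 'rV[R]_n}) :
  (matrix_of_form b)^T = matrix_of_form b.
Proof.
by apply/matrixP => i j; rewrite !mxE (hermC b) expr0 mul1r.
Qed.

Lemma gram_matrix_rows {R : realType} {n : nat} (b : {symmetric 'rV[R]_n}) (P : 'M[R]_n) :
  gram_matrix b [tuple row i P | i < n] = P *m matrix_of_form b *m P^T.
Proof.
apply/matrixP => i j; rewrite mxE !tnth_mktuple symmetric_formE /mxform.
by rewrite tr_row -!row_mul !mxE; apply: eq_bigr => k _; rewrite !mxE.
Qed.

Lemma unitmx_basis_rows {R : fieldType} {n : nat} (P : 'M[R]_n) :
  P \in unitmx -> basis_of fullv [tuple row i P | i < n].
Proof.
rewrite -row_free_unit => fP.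
rewrite basisEfree subvf size_tuple dimvf /dim /= mul1n leqnn !andbT.
apply/(@freeP _ _ n [tuple row i P | i < n]) => k k0 i.
have /rowP/(_ i) : \row_j k j = 0.
  apply: (row_free_inj fP); rewrite mul0mx mulmx_sum_row -[RHS]k0.
  by apply: eq_bigr => j _; rewrite mxE (nth_map j) ?size_enum_ord // nth_ord_enum.
by rewrite !mxE.
Qed.

(** Serves to undo the sign changes that made both forms nonnegative. *)
Lemma is_diag_mxZ_inv {R : fieldType} {n : nat} (e : R) (A : 'M[R]_n) :
  e != 0 -> is_diag_mx (e *: A) -> is_diag_mx A.
Proof.
move=> e0 /is_diag_mxP dA; apply/is_diag_mxP => i j ij.
by apply/eqP; have /eqP := dA i j ij; rewrite mxE mulf_eq0 (negPf e0).
Qed.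

Theorem theorem2 (R : realType) (n : nat) (q r : 'rV[R]_n -> R)
    (hq : is_quadratic_form q) (hr : is_quadratic_form r)
    (sq : semi_definite q) (sr : semi_definite r)
    (hZ : zero_set q `<=` zero_set r) :
  simultaneously_diagonalizable r q.
Proof.
have [bq hbq] := hq; have [br hbr] := hr.
have [d d0 pq] := semi_definite_sign sq.
have [e e0 pr] := semi_definite_sign sr.
(* [B] comes from [q] because zeros of the second form of the pencil must be zeros of the first. *)
pose A := matrix_of_form br; pose B := matrix_of_form bq.
have qE x : mxform (d *: B) x x = d * q x.
  by rewrite mxform_scale hbq symmetric_formE.
have rE x : mxform (e *: A) x x = e * r x.
  by rewrite mxform_scale hbr symmetric_formE.
have [||||| P [uP dA dB]] := psd_pencil_diagonalizable n (e *: A) (d *: B).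
- by rewrite linearZ /= matrix_of_symmetric_form.
- by rewrite linearZ /= matrix_of_symmetric_form.
- by move=> x; rewrite rE.
- by move=> x; rewrite qE.
- move=> x; rewrite qE rE => /eqP; rewrite mulf_eq0 (negPf d0) => /eqP qx.
  by rewrite (hZ x qx) mulr0.
exists br, bq; split=> //; exists [tuple row i P | i < n].
split; first exact: unitmx_basis_rows.
- rewrite gram_matrix_rows; apply: (is_diag_mxZ_inv e) => //.
  by rewrite scalemxAl scalemxAr.
- rewrite gram_matrix_rows; apply: (is_diag_mxZ_inv d) => //.
  by rewrite scalemxAl scalemxAr.
Qed.
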